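(* Let $n\ge2$, let $\phi_1,\dots,\phi_n\in\mathbb C$ be pairwise distinct, let $\beta\in\mathbb C\setminus\{0,1\}$, and let $\hat R$ be the rime matrix with entries (no summation) $$\hat R^{ij}_{kl}=(1-\beta_{ji})\delta^i_l\delta^j_k+\beta_{ij}\delta^i_k\delta^j_l-\beta_{ij}\delta^i_k\delta^i_l+\beta_{ji}\delta^j_k\delta^j_l,\qquad \beta_{ij}=\frac{\beta\phi_i}{\phi_i-\phi_j}\ (i\neq j),\ \beta_{ii}=0 .$$ Let $q\in\mathbb C^\times$ be such that $q^{-2}=1-\beta$, and let $\hat R_{CG}$ be the Cremmer--Gervais matrix with entries $$(\hat R_{CG})^{ij}_{kl}=q^{-2\theta_{ij}}\delta^i_l\delta^j_k+(1-q^{-2})\sum_{s:\,i\le s<j}\delta^s_k\delta^{i+j-s}_l-(1-q^{-2})\sum_{s:\,j<s<i}\delta^s_k\delta^{i+j-s}_l .$$ Then the matrix $X$ with entries $$X^k_j=e_{j-1}(\phi_1,\dots,\hat\phi_k,\dots,\phi_n)$$ is invertible, its inverse is $$(X^{-1})^j_i=\frac{(-1)^{j-1}\phi_i^{\,n-j}}{\prod_{k:\,k\ne i}(\phi_i-\phi_k)},$$ and $$\hat R=(X\otimes X)\,\hat R_{CG}\,(X^{-1}\otimes X^{-1}) .$$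
   Context: For the standard basis $e_1,\dots,e_n$ of $\mathbb C^n$, entries of an operator on $\mathbb C^n\otimes\mathbb C^n$ are defined by $\hat R(e_k\otimes e_l)=\sum_{i,j}\hat R^{ij}_{kl}\,e_i\otimes e_j$, and entries of an operator $A$ on $\mathbb C^n$ by $A(e_j)=\sum_k A^k_je_k$ (upper index is the row). $\theta_{ij}=1$ if $i>j$ and $\theta_{ij}=0$ if $i\le j$. In the formula for $X$, $e_m(x_1,\dots,x_N)=\sum_{s_1<\dots<s_m}x_{s_1}\cdots x_{s_m}$ is the elementary symmetric polynomial ($e_0=1$), and the hat over $\phi_k$ means that $\phi_k$ is omitted. *)

(* Defs.v *)
From HB Require Import structures.
From mathcomp Require Import all_boot all_order all_algebra.
From mathcomp Require Import reals.
From mathcomp Require Import complex mxtens.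
From mathcomp.multinomials Require mpoly.

Set Implicit Arguments.
Unset Strict Implicit.
Unset Printing Implicit Defensive.

Import Order.TTheory GRing.Theory Num.Theory.
Local Open Scope ring_scope.

(* All indices are 0-based: the i-th index of {1, ..., n} is the element of
   'I_n with value i - 1. *)

(* The matrix of the operator E on F^n (x) F^n with
     E (e_k (x) e_l) = \sum_(i, j) E i j k l (e_i (x) e_j),
   i.e. E^{ij}_{kl} = E i j k l, in the basis ordering used by A *t B, so that
   A *t B has the entries A i k * B j l. *)
Definition op2mx (F : fieldType) (n : nat)
    (E : 'I_n -> 'I_n -> 'I_n -> 'I_n -> F) : 'M[F]_(n * n) :=
  \matrix_(r, c) E (mxtens_unindex r).1 (mxtens_unindex r).2
                   (mxtens_unindex c).1 (mxtens_unindex c).2.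

Definition kdelta (F : fieldType) (n : nat) (i j : 'I_n) : F := (i == j)%:R.

Definition rime_beta (F : fieldType) (n : nat) (beta : F) (phi : 'I_n -> F)
    (i j : 'I_n) : F :=
  if i == j then 0 else beta * phi i / (phi i - phi j).

Definition rime_mx (F : fieldType) (n : nat) (beta : F) (phi : 'I_n -> F) :
    'M[F]_(n * n) :=
  let b := rime_beta beta phi in
  let d := @kdelta F n in
  op2mx (fun i j k l : 'I_n =>
    (1 - b j i) * d i l * d j k + b i j * d i k * d j l
    - b i j * d i k * d i l + b j i * d j k * d j l).

(* The condition l = i + j - s is on the values of the indices; it is
   unaffected by the shift to 0-based indices, and the subtraction never
   truncates since s <= maxn i j on both summation ranges. *)
Definition cremmer_gervais_mx (F : fieldType) (n : nat) (q : F) :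
    'M[F]_(n * n) :=
  let d := @kdelta F n in
  let theta (i j : 'I_n) : nat := (j < i)%N in
  op2mx (fun i j k l : 'I_n =>
    q ^- (2 * theta i j)%N * d i l * d j k
    + (1 - q ^- 2) *
        \sum_(s < n | (i <= s < j)%N) d s k * (i + j - s == l)%N%:R
    - (1 - q ^- 2) *
        \sum_(s < n | (j < s < i)%N) d s k * (i + j - s == l)%N%:R).

(* [lift k] enumerates the indices different from k. *)
Definition rime_X (F : fieldType) (n : nat) (phi : 'I_n -> F) : 'M[F]_n :=
  \matrix_(k, j)
    mpoly.meval (fun s : 'I_n.-1 => phi (lift k s)) (mpoly.mesym n.-1 F j).

(* With 0-based j, the exponents j - 1 and n - j of the 1-based formula become
   j and n - j.+1. *)
Definition rime_Xinv (F : fieldType) (n : nat) (phi : 'I_n -> F) : 'M[F]_n :=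
  \matrix_(j, i)
    ((-1) ^+ j * phi i ^+ (n - j.+1) / \prod_(k < n | k != i) (phi i - phi k)).

(* Main.v *)
Require Import Defs.
From mathcomp Require Import all_boot all_order all_algebra.
From mathcomp Require Import reals.
From mathcomp Require Import complex mxtens.
From mathcomp.multinomials Require mpoly.
From mathcomp Require Import ring zify.

(** Write [V] for [rime_Xinv phi], [N = n - 1], and
    [D_k = \prod_(i != k) (phi k - phi i)].  Column [k] of [V] is [1 / D_k]
    times the signed monomial vector [v(phi k)], where
    [v(x)_s = (-1)^s x^(N - s)].

    Vieta's formula says that row [k] of [X], paired with [v(x)], gives
    [\prod_(i != k) (x - phi i)]; at [x = phi i] this is [D_k] if [i = k] and
    [0] otherwise, so [X V = 1] ([rime_X_mul_Xinv]).  It remains to show that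
    [V (x) V] intertwines the two braid matrices,
    [(V (x) V) Rhat = R_CG (V (x) V)] ([rime_mx_intertwine]), which is checked on
    the column indexed by [(k, l)].  With [x = phi k] and [y = phi l],

    - if [k != l], the two sums in [R_CG (v(x) (x) v(y))] are geometric; times
      [x - y] they telescope to two boundary monomials ([geometric_window]),
      and these give the combination
      [(1 - beta_kl) v(y) (x) v(x) + beta_kl v(x) (x) v(y)] dictated by [Rhat];

    - if [k = l], the sums have constant terms, so that
      [R_CG (v(x) (x) v(x))] has the entries
      [(1 + beta (j - i)) v(x)_i v(x)_j].  On the other side, [Rhat] maps
      [e_k (x) e_k] to itself plus
      [\sum_j beta_kj (e_j (x) e_k - e_k (x) e_j)], so one needs the vector
      [\sum_j beta_kj V e_j].  Its [s]-th entry is [v(x)_s] times an affine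
      function of [s] with slope [- beta / D_k] ([sum_cauchy_pow]); the constant
      part cancels in the antisymmetrization and the slope produces
      [beta (j - i)].

    The affine dependence comes from a recursion in the exponent, whose input is
    the vanishing of [\sum_j phi_j^p / D_j] for [p < N]
    ([sum_pow_div_node_prod]); that vanishing is the first column of [V X = 1],
    since the first column of [X] is constantly [1]. *)

Set Implicit Arguments.
Unset Strict Implicit.
Unset Printing Implicit Defensive.

Import Order.TTheory GRing.Theory Num.Theory.
Local Open Scope ring_scope.

(** * The inverse of X *)

Lemma vieta_meval (F : idomainType) (m : nat) (f : 'I_m -> F) (x : F) :
  \sum_(j < m.+1) (-1) ^+ j * mpoly.meval f (mpoly.mesym m F j) * x ^+ (m - j)
  = \prod_(i < m) (x - f i).
Proof.
pose cs := [tuple f i | i < m].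
pose P := \prod_(c <- cs) ('X - c%:P).
have sP : size P = m.+1 by rewrite size_prod_XsubC size_tuple.
have -> : \prod_(i < m) (x - f i) = P.[x].
  rewrite /P horner_prod big_tuple; apply: eq_bigr => i _.
  by rewrite hornerXsubC tnth_mktuple.
rewrite horner_coef sP (reindex_inj rev_ord_inj) /=.
apply: eq_bigr => j _; rewrite subSS.
have jm : (j <= m)%N by rewrite -ltnS.
have km : (m - j < m.+1)%N by rewrite ltnS leq_subr.
have := mpoly.mroots_coeff cs (Ordinal km).
rewrite /= subKn // -/P => ->; congr (_ * _ * _).
by apply: mpoly.meval_eq => i; rewrite tnth_mktuple.
Qed.

Definition node_prod (F : fieldType) (n : nat) (phi : 'I_n -> F) (i : 'I_n) : F :=
  \prod_(k < n | k != i) (phi i - phi k).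

Lemma node_prod_neq0 (F : fieldType) (n : nat) (phi : 'I_n -> F) (i : 'I_n) :
  injective phi -> node_prod phi i != 0.
Proof.
move=> phi_inj; apply/prodf_neq0 => k ki; rewrite subr_eq0.
by apply: contra ki => /eqP /phi_inj ->.
Qed.

Lemma node_prod_lift (F : fieldType) (m : nat) (phi : 'I_m.+1 -> F)
    (i : 'I_m.+1) :
  node_prod phi i = \prod_(s < m) (phi i - phi (lift i s)).
Proof.
rewrite /node_prod big_mkcond (bigD1_ord i) //= eqxx mul1r.
by apply: eq_bigr => s _; rewrite eq_sym neq_lift.
Qed.

(** By Vieta, the [(k, i)] entry of the product is
    [\prod_(s != k) (phi i - phi s) / D_i]; for [k != i] the factor [s = i]
    vanishes. *)
Lemma rime_X_mul_Xinv (F : fieldType) (m : nat) (phi : 'I_m.+1 -> F) :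
  injective phi -> rime_X phi *m rime_Xinv phi = 1%:M.
Proof.
move=> phi_inj; apply/matrixP => k i; rewrite !mxE.
transitivity ((\prod_(s < m) (phi i - phi (lift k s))) / node_prod phi i).
  rewrite -vieta_meval mulr_suml; apply: eq_bigr => j _.
  by rewrite !mxE subSS /node_prod; ring.
have [->|ki] := eqVneq k i.
  by rewrite -node_prod_lift divff ?node_prod_neq0.
case: (unliftP k i) ki => [s ->|->]; last by rewrite eqxx.
by move=> _; rewrite (bigD1 s) //= subrr !mul0r.
Qed.

(** * Power sums over the nodes *)

(** The divided difference of a polynomial of degree less than the number of
    nodes minus one vanishes.  Here it is read off the entry [(m - p, 0)] of
    [V X = 1], as [X] has the constant first column [e_0 = 1]. *)
Lemma sum_pow_div_node_prod (F : fieldType) (m : nat) (phi : 'I_m.+1 -> F) p :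
  injective phi -> (p < m)%N ->
  \sum_(i < m.+1) phi i ^+ p / node_prod phi i = 0.
Proof.
move=> phi_inj pm.
have mp : (m - p < m.+1)%N by rewrite ltnS leq_subr.
have /matrixP/(_ (Ordinal mp) ord0) := mulmx1C (rime_X_mul_Xinv phi_inj).
rewrite !mxE -val_eqE /= subn_eq0 leqNgt pm /= => H.
apply: (@mulfI _ ((-1) ^+ (m - p))); first by rewrite signr_eq0.
rewrite mulr0 -[RHS]H mulr_sumr; apply: eq_bigr => i _.
rewrite !mxE /= mpoly.mesym0E mpoly.meval1 mulr1 mulrA.
by rewrite subSS subKn // ltnW.
Qed.

(** Let [S_p] be the left-hand side, [x = phi k], [y = phi j].  From
    [x / (x - y) * y^(p + 1) = x * (x / (x - y) * y^p) - x * y^p] one gets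
    [S_(p + 1) = x S_p - x \sum_(j != k) phi_j^p / D_j], and the last sum is
    [- x^p / D_k] because the full sum over [j] vanishes.  Hence each step
    multiplies by [x] and adds [x^(p + 1) / D_k]. *)
Lemma sum_cauchy_pow (F : fieldType) (m : nat) (phi : 'I_m.+1 -> F) (k : 'I_m.+1)
    (p : nat) : injective phi -> (p <= m)%N ->
  \sum_(j < m.+1 | j != k)
     phi k / (phi k - phi j) * (phi j ^+ p / node_prod phi j)
  = phi k ^+ p * (\sum_(j < m.+1 | j != k)
                    phi k / (phi k - phi j) / node_prod phi j
                  + p%:R / node_prod phi k).
Proof.
move=> phi_inj; elim: p => [_|p IHp pm].
  rewrite mul1r mul0r addr0; apply: eq_bigr => j _; rewrite expr0.
  by rewrite mul1r.
have := sum_pow_div_node_prod phi_inj pm.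
rewrite (bigD1 k) //= => /eqP; rewrite addrC addr_eq0 => /eqP H.
transitivity (\sum_(j < m.+1 | j != k)
   (phi k * (phi k / (phi k - phi j) * (phi j ^+ p / node_prod phi j)) -
    phi k * (phi j ^+ p / node_prod phi j))).
  apply: eq_bigr => j jk.
  have ne : phi k - phi j != 0.
    by rewrite subr_eq0; apply: contra jk => /eqP /phi_inj ->.
  have nD := node_prod_neq0 j phi_inj.
  by rewrite exprS; field; rewrite ne nD.
rewrite sumrB -!mulr_sumr H IHp 1?ltnW // exprS mulrSr.
by ring.
Qed.

(** The hypotheses on [a], [b], [c] say that none of the truncated differences
    [m - s], [c - s], [m - (c - s)] truncates for [s] between [a] and [b]. *)
Lemma geometric_window (R : comPzRingType) (x y : R) (m a b c : nat) :
  (a <= b <= m)%N -> (b <= c <= m + a)%N ->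
  (x - y) * \sum_(a <= s < b) x ^+ (m - s) * y ^+ (m - (c - s))
  = x ^+ (m - a).+1 * y ^+ (m - (c - a)) - x ^+ (m - b).+1 * y ^+ (m - (c - b)).
Proof.
case/andP=> ab bm /andP[bc cma]; rewrite mulr_sumr.
rewrite (@telescope_sumr_eq _ a b
  (fun s => - (x ^+ (m - s).+1 * y ^+ (m - (c - s))))) //.
  by rewrite opprK addrC.
move=> s /andP[as_ sb].
have -> : (m - s = (m - s.+1).+1)%N by lia.
have -> : (m - (c - s.+1) = (m - (c - s)).+1)%N by lia.
by rewrite !exprS; ring.
Qed.

(** * Entries of products with tensor squares *)

Lemma tensmx11 (F : fieldType) (n : nat) :
  (1%:M : 'M[F]_n) *t (1%:M : 'M[F]_n) = 1%:M.
Proof.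
apply/matrixP => r c; case: (mxtens_indexP r) => i j.
case: (mxtens_indexP c) => k l; rewrite tensmxE !mxE.
by rewrite (can_eq (@mxtens_indexK n n)) xpair_eqE -natrM mulnb.
Qed.

Lemma mul_op2mx_tens (F : fieldType) (n : nat) E (A B : 'M[F]_n) i j k l :
  (op2mx E *m (A *t B)) (mxtens_index (i, j)) (mxtens_index (k, l))
  = \sum_a \sum_b E i j a b * (A a k * B b l).
Proof.
rewrite mxE pair_big (reindex (@mxtens_index n n)) /=; last first.
  by exists (@mxtens_unindex n n) => ? _; rewrite (mxtens_indexK, mxtens_unindexK).
by apply: eq_bigr => -[a b] _; rewrite tensmxE !mxE !mxtens_indexK.
Qed.

Lemma mul_tens_op2mx (F : fieldType) (n : nat) E (A B : 'M[F]_n) i j k l :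
  ((A *t B) *m op2mx E) (mxtens_index (i, j)) (mxtens_index (k, l))
  = \sum_a \sum_b A i a * B j b * E a b k l.
Proof.
rewrite mxE pair_big (reindex (@mxtens_index n n)) /=; last first.
  by exists (@mxtens_unindex n n) => ? _; rewrite (mxtens_indexK, mxtens_unindexK).
by apply: eq_bigr => -[a b] _; rewrite tensmxE !mxE !mxtens_indexK.
Qed.

Lemma sum_kdelta (F : fieldType) (n : nat) (f : 'I_n -> F) (i : 'I_n) :
  \sum_a f a * kdelta F a i = f i.
Proof.
rewrite (bigD1 i) //= /kdelta eqxx mulr1 big1 ?addr0 // => a /negbTE ->.
by rewrite mulr0.
Qed.

Lemma kdeltaC (F : fieldType) (n : nat) (i j : 'I_n) : kdelta F i j = kdelta F j i.
Proof. by rewrite /kdelta eq_sym. Qed.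

Lemma sum_ord_window (V : nmodType) (n a b : nat) (f : nat -> V) :
  (b <= n)%N -> \sum_(s < n | (a <= s < b)%N) f s = \sum_(a <= s < b) f s.
Proof.
move=> bn; rewrite (big_nat_widen _ _ _ _ _ bn) (big_nat_widenl a 0) //.
rewrite big_mkord; apply: eq_bigl => s; by rewrite andbC.
Qed.

(** The columns are given by functions on [nat], since the index [i + j - s] of
    the Cremmer-Gervais sums is a natural number and not an ordinal. *)
Lemma cremmer_gervais_tens (F : fieldType) (n : nat) (q : F) (A : 'M[F]_n)
   (u v : nat -> F) (k l : 'I_n) :
  (forall s : 'I_n, A s k = u s) -> (forall s : 'I_n, A s l = v s) ->
  forall i j : 'I_n,
  (cremmer_gervais_mx n q *m (A *t A)) (mxtens_index (i, j)) (mxtens_index (k, l))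
  = q ^- (2 * (j < i))%N * (u j * v i)
    + (1 - q ^- 2) * (\sum_(i <= s < j) u s * v (i + j - s)%N)
    - (1 - q ^- 2) * (\sum_(j.+1 <= s < i) u s * v (i + j - s)%N).
Proof.
move=> Au Av i j; rewrite mul_op2mx_tens.
(* On a window where i + j - s is an index, the two deltas evaluate the double
   sum over (a, b) at (s, i + j - s). *)
have window (P : pred 'I_n) :
    (forall s : 'I_n, P s -> (s <= i + j)%N && (i + j - s < n)%N) ->
  \sum_(a < n) \sum_(b < n) (\sum_(s < n | P s) kdelta F s a * (i + j - s == b)%N%:R)
     * (A a k * A b l) = \sum_(s < n | P s) u s * v (i + j - s)%N.
  move=> hP.
  transitivity (\sum_(s < n | P s) \sum_(a < n) \sum_(b < n)
     kdelta F s a * (i + j - s == b)%N%:R * (A a k * A b l)).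
    rewrite [RHS]exchange_big /=; apply: eq_bigr => a _.
    rewrite [RHS]exchange_big /=; apply: eq_bigr => b _.
    by rewrite mulr_suml.
  apply: eq_bigr => s /hP /andP[_ sn].
  pose t := Ordinal sn.
  transitivity (\sum_a (A a k * \sum_b A b l * kdelta F b t) * kdelta F a s).
    apply: eq_bigr => a _; rewrite mulr_sumr mulr_suml; apply: eq_bigr => b _.
    rewrite (kdeltaC _ s a) /kdelta -[b == t]val_eqE /= [(b : nat) == _]eq_sym.
    by ring.
  by rewrite sum_kdelta sum_kdelta Au Av.
transitivity (
 \sum_a (q ^- (2 * (j < i))%N * \sum_b (A a k * A b l) * kdelta F b i) * kdelta F a j
  + (1 - q ^- 2) * (\sum_(a < n) \sum_(b < n)
      (\sum_(s < n | (i <= s < j)%N) kdelta F s a * (i + j - s == b)%N%:R)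
     * (A a k * A b l))
  - (1 - q ^- 2) * (\sum_(a < n) \sum_(b < n)
      (\sum_(s < n | (j < s < i)%N) kdelta F s a * (i + j - s == b)%N%:R)
     * (A a k * A b l))).
  rewrite !mulr_sumr -!sumrN -!big_split /=; apply: eq_bigr => a _.
  rewrite !mulr_sumr mulr_suml -!sumrN -!big_split /=; apply: eq_bigr => b _.
  by rewrite (kdeltaC _ i b) (kdeltaC _ j a); ring.
rewrite !window; last 2 first.
- by move=> s /andP[h1 h2]; have := ltn_ord i; have := ltn_ord j; lia.
- by move=> s /andP[h1 h2]; have := ltn_ord i; have := ltn_ord j; lia.
rewrite sum_kdelta sum_kdelta Au Av.
by rewrite -!(@sum_ord_window _ n) // ltnW.
Qed.

Lemma rime_tens (F : fieldType) (n : nat) (beta : F) (phi : 'I_n -> F)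
  (A : 'M[F]_n) (i j k l : 'I_n) :
  ((A *t A) *m rime_mx beta phi) (mxtens_index (i, j)) (mxtens_index (k, l))
  = (1 - rime_beta beta phi k l) * (A i l * A j k)
    + rime_beta beta phi k l * (A i k * A j l)
    - kdelta F k l * (A i k * (\sum_b rime_beta beta phi k b * A j b))
    + kdelta F k l * (A j k * (\sum_a rime_beta beta phi k a * A i a)).
Proof.
rewrite mul_tens_op2mx.
set be := rime_beta beta phi.
transitivity (
  \sum_a (\sum_b (1 - be b a) * (A i a * A j b) * kdelta F b k) * kdelta F a l
  + \sum_a (\sum_b be a b * (A i a * A j b) * kdelta F b l) * kdelta F a k
  - \sum_a (A i a * (\sum_b be a b * A j b) * kdelta F a l) * kdelta F a k
  + \sum_b (A j b * (\sum_a be b a * A i a) * kdelta F b l) * kdelta F b k).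
  have -> : \sum_b (A j b * (\sum_a be b a * A i a) * kdelta F b l) * kdelta F b k
   = \sum_a \sum_b A j b * (be b a * A i a) * kdelta F b l * kdelta F b k.
    rewrite exchange_big /=; apply: eq_bigr => b _.
    by rewrite mulr_sumr !mulr_suml.
  rewrite -!sumrN -!big_split /=; apply: eq_bigr => a _.
  rewrite !mulr_sumr !mulr_suml -!sumrN -!big_split /=; apply: eq_bigr => b _.
  by ring.
rewrite !sum_kdelta.
by ring.
Qed.

(** * The intertwining relation *)

(** Compared column by column: the geometric sums of the Cremmer-Gervais matrix
    telescope for distinct nodes, and count their terms for equal nodes. *)
Lemma rime_mx_intertwine (F : fieldType) (m : nat) (phi : 'I_m.+1 -> F)
    (beta q : F) :
  injective phi -> q ^- 2 = 1 - beta ->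
  let V := rime_Xinv phi in
  (V *t V) *m rime_mx beta phi = cremmer_gervais_mx m.+1 q *m (V *t V).
Proof.
move=> phi_inj hq V; apply/matrixP => r c.
case: (mxtens_indexP r) => i j; case: (mxtens_indexP c) => k l.
pose w (x : 'I_m.+1) (s : nat) : F :=
  (-1) ^+ s * (phi x ^+ (m - s) / node_prod phi x).
have VE (s x : 'I_m.+1) : V s x = w x s by rewrite mxE subSS /w mulrA.
rewrite rime_tens (@cremmer_gervais_tens _ _ _ _ (w k) (w l)) //.
rewrite !VE hq subKr.
have [im jm] : (i <= m)%N /\ (j <= m)%N by split; rewrite -ltnS.
(* The indices s and i + j - s have a constant sum, so that the signs factor
   out of the sums. *)
have wprod a b : (a <= b)%N -> (b <= i + j)%N ->
  \sum_(a <= s < b) w k s * w l (i + j - s)%N =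
  (-1) ^+ (i + j) / (node_prod phi k * node_prod phi l)
   * \sum_(a <= s < b) phi k ^+ (m - s) * phi l ^+ (m - (i + j - s)).
  move=> ab bc; rewrite mulr_sumr; apply: eq_big_nat => s /andP[_ sb].
  have sij : (s <= i + j)%N by lia.
  by rewrite /w -{3}(subnKC sij) exprD invfM; ring.
have qtheta : q ^- (2 * (j < i))%N = 1 - beta *+ (j < i).
  by case: (j < i)%N; rewrite ?muln1 ?hq ?muln0 ?expr0 ?invr1 ?mulr1n ?mulr0n ?subr0.
rewrite qtheta; have nk := node_prod_neq0 k phi_inj.
have [kl|kl] := eqVneq k l.
  subst l; rewrite /kdelta eqxx !mul1r.
  pose S0 := \sum_(a < m.+1 | a != k)
                    phi k / (phi k - phi a) / node_prod phi a.
  (* Up to the signed monomial this is affine in s; S0 drops out of the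
     antisymmetrized expression in which the sum occurs. *)
  have wsum (s : 'I_m.+1) : \sum_b rime_beta beta phi k b * V s b =
    beta * (-1) ^+ s * phi k ^+ (m - s) * (S0 + (m - s)%:R / node_prod phi k).
    have ms : (m - s <= m)%N by rewrite leq_subr.
    have := sum_cauchy_pow k phi_inj ms; rewrite -/S0 => H.
    rewrite -!mulrA -H (bigD1 k) //= /rime_beta eqxx mul0r add0r !mulr_sumr.
    apply: eq_bigr => b bk; rewrite eq_sym (negbTE bk) VE /w; ring.
  rewrite !wsum.
  have diag a b : (a <= b <= m)%N -> (b <= i + j <= m + a)%N ->
   \sum_(a <= s < b) phi k ^+ (m - s) * phi k ^+ (m - (i + j - s))
   = (b - a)%:R * (phi k ^+ (m - i) * phi k ^+ (m - j)).
    move=> h1 h2; rewrite -exprD.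
    rewrite (eq_big_nat _ _ (F2 := fun=> phi k ^+ (m - i + (m - j)))).
      by rewrite sumr_const_nat mulr_natl.
    by move=> s hs; rewrite -exprD; congr (_ ^+ _); lia.
  rewrite /rime_beta eqxx.
  case: (ltnP j i) => ij; rewrite ?mulr1n ?mulr0n.
    rewrite (@big_geq _ _ _ i j) 1?ltnW //.
    rewrite wprod //; try lia.
    rewrite diag; try lia.
    rewrite /w !natrB // ?exprD -1?[j.+1]addn1 ?natrD; try lia.
    by field; rewrite nk.
  rewrite (@big_geq _ _ _ j.+1 i) //; last lia.
  rewrite wprod //; try lia.
  rewrite diag; try lia.
  rewrite /w !natrB // exprD.
  by field; rewrite nk.
have nl := node_prod_neq0 l phi_inj.
have ne : phi k - phi l != 0.
  by rewrite subr_eq0; apply: contra kl => /eqP /phi_inj ->.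
rewrite /kdelta /rime_beta (negbTE kl) !mul0r subr0 addr0.
case: (ltnP j i) => ij; rewrite ?mulr1n ?mulr0n.
  rewrite (@big_geq _ _ _ i j) 1?ltnW // wprod //; try lia.
  have h1 : (j.+1 <= i <= m)%N by lia.
  have h2 : (i <= i + j <= m + j.+1)%N by lia.
  have := geometric_window (phi k) (phi l) h1 h2.
  set S := \sum_(_ <= _ < _) _ => H.
  have -> : S = (phi k ^+ (m - j) * phi l ^+ (m - i) * phi l
    - phi k * phi k ^+ (m - i) * phi l ^+ (m - j)) / (phi k - phi l).
    apply: (mulfI ne); rewrite H mulrCA divff // mulr1.
    have -> : (m - j = (m - j.+1).+1)%N by lia.
    have -> : (m - (i + j - j.+1) = (m - i).+1)%N by lia.
    have -> : (m - (i + j - i) = (m - j.+1).+1)%N by lia.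
    by rewrite !exprS; ring.
  by rewrite /w exprD; field; rewrite nk nl ne.
rewrite (@big_geq _ _ _ j.+1 i) // 1?ltnW // wprod //; try lia.
have h1 : (i <= j <= m)%N by lia.
have h2 : (j <= i + j <= m + i)%N by lia.
have := geometric_window (phi k) (phi l) h1 h2.
rewrite addKn addnK.
set S := \sum_(_ <= _ < _) _ => H.
have -> : S = (phi k * phi k ^+ (m - i) * phi l ^+ (m - j)
    - phi k * phi k ^+ (m - j) * phi l ^+ (m - i)) / (phi k - phi l).
  by apply: (mulfI ne); rewrite H mulrCA divff // mulr1 !exprS.
by rewrite /w exprD; field; rewrite nk nl ne.
Qed.

Theorem proposition4 (R : realType) (n : nat) (phi : 'I_n -> R[i])
    (beta q : R[i]) (hn : (2 <= n)%N) (hphi : injective phi)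
    (hbeta0 : beta != 0) (hbeta1 : beta != 1)
    (hq0 : q != 0) (hq : q ^- 2 = 1 - beta) :
  [/\ rime_X phi \in unitmx,
      invmx (rime_X phi) = rime_Xinv phi
    & rime_mx beta phi =
      (rime_X phi *t rime_X phi) *m cremmer_gervais_mx n q
        *m (invmx (rime_X phi) *t invmx (rime_X phi))].
Proof.
case: n phi hn hphi => [//|m] phi _ hphi.
have XV := rime_X_mul_Xinv hphi.
have Xu : rime_X phi \in unitmx by case/mulmx1_unit: XV.
have XI : invmx (rime_X phi) = rime_Xinv phi.
  by rewrite -[LHS]mulmx1 -XV mulKmx.
split=> //.
by rewrite XI -mulmxA -(rime_mx_intertwine hphi hq) mulmxA tensmx_mul XV
  tensmx11 mul1mx.
Qed.
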